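(* Let $K\in\{2,3,\dots\}$ and $r\in[-\infty,-1)$. Let $H_1,\dots,H_K$ be composite null hypotheses (sets of probability measures on a common measurable space), and for each $k$ let $p_k$ be a $[0,1]$-valued p-value for testing $H_k$. For each $k$ define the adjusted p-value $$p_k^*:=\max_{I:\,k\in I\subseteq\{1,\dots,K\}}\frac{r}{r+1}|I|^{1+1/r}M_{r,|I|}(p_I),$$ where $p_I$ is the vector of the $p_k$ with $k\in I$. Then for every probability measure $\mathbb{P}$ on the measurable space such that the set $I:=\{k\mid\mathbb{P}\in H_k\}$ of indices of true hypotheses is non-empty, $$\mathbb{P}\left(\min_{k\in I}p_k^*\le\epsilon\right)\le\epsilon\quad\text{for all }\epsilon\in(0,1).$$ Equivalently, the procedure that, for a given significance level $\epsilon\in(0,1)$, rejects $H_k$ if and only if $\frac{r}{r+1}|I|^{1+1/r}M_{r,|I|}(p_I)\le\epsilon$ for all $I\subseteq\{1,\dots,K\}$ with $k\in I$ has family-wise error rate (the probability of rejecting at least one true hypothesis) at most $\epsilon$.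
   Context: A p-value for testing $H_k$ is a random variable $p_k$ with $\mathbb{P}(p_k\le\epsilon)\le\epsilon$ for all $\epsilon\in(0,1)$ and all $\mathbb{P}\in H_k$; the dependence between $p_1,\dots,p_K$ is arbitrary. For $n\ge1$ and $r\in(-\infty,0)$, $M_{r,n}(q_1,\dots,q_n):=\left(\frac{q_1^r+\dots+q_n^r}{n}\right)^{1/r}$ on $[0,1]^n$ (equal to $0$ if some $q_i=0$), and $M_{-\infty,n}(q_1,\dots,q_n):=\min(q_1,\dots,q_n)$. For $r=-\infty$, $\frac{r}{r+1}$ is understood as $1$ and $|I|^{1+1/r}$ as $|I|$. *)

(* Defs.v *)
From HB Require Import structures.
From mathcomp Require Import all_boot all_order all_algebra.
From mathcomp Require Import all_classical all_reals all_analysis.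

Set Implicit Arguments.
Unset Strict Implicit.
Unset Printing Implicit Defensive.

Import Order.TTheory GRing.Theory Num.Theory.
Import numFieldNormedType.Exports.

Local Open Scope classical_set_scope.
Local Open Scope ring_scope.

(** A hypothesis is a set of probability measures on [T].  As [{mfun T >-> R}]
    does not mention a measure, one random variable serves for all of them. *)
Definition is_pvalue (d : measure_display) (T : measurableType d)
    (R : realType) (H : set (probability T R)) (p : {mfun T >-> R}) : Prop :=
  forall P : probability T R, H P ->
  forall eps : R, 0 < eps < 1 -> (P [set w | (p w <= eps)%R] <= eps%:E)%E.

(** The mean M_{r,n} for [-oo <= r < 0] and [n >= 1], with arguments in [0, 1].
    The zero case must be explicit because [0 `^ s = 0] for [s < 0].  In the
    case [-oo], the unit [1] of the iterated minimum is harmless on [0, 1].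
    The value for [+oo] is junk. *)
Definition genmean (R : realType) (r : \bar R) (n : nat) (q : 'I_n -> R) : R :=
  match r with
  | EFin s =>
      if [exists i, q i == 0] then 0
      else ((\sum_(i < n) q i `^ s) / n%:R) `^ s^-1
  | -oo%E => \big[Num.min/1]_(i < n) q i
  | +oo%E => 0
  end.

(** r / (r + 1) * n ^ (1 + 1 / r), read as n for [r = -oo]; junk for [+oo]. *)
Definition merge_coef (R : realType) (r : \bar R) (n : nat) : R :=
  match r with
  | EFin s => s / (s + 1) * n%:R `^ (1 + s^-1)
  | -oo%E => n%:R
  | +oo%E => 0
  end.

(** The combined p-value for the intersection hypothesis indexed by [I]; the
    vector p_I lists the [p k w], [k \in I], in increasing order of [k]. *)
Definition merged_pvalue (T : Type) (R : realType) (K : nat) (r : \bar R)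
    (p : 'I_K -> T -> R) (I : {set 'I_K}) (w : T) : R :=
  merge_coef r #|I| * genmean r (fun j : 'I_#|I| => p (enum_val j) w).

(** The combined p-values are nonnegative when [r < -1], so the unit [0] of the
    iterated maximum does not affect its value. *)
Definition adjusted_pvalue (T : Type) (R : realType) (K : nat) (r : \bar R)
    (p : 'I_K -> T -> R) (k : 'I_K) (w : T) : R :=
  \big[Num.max/0]_(I : {set 'I_K} | k \in I) merged_pvalue r p I w.

(** The event that the procedure at level [eps] rejects the [k]-th hypothesis. *)
Definition rejects (T : Type) (R : realType) (K : nat) (r : \bar R)
    (p : 'I_K -> T -> R) (eps : R) (k : 'I_K) : set T :=
  [set w | forall I : {set 'I_K}, k \in I -> merged_pvalue r p I w <= eps].

(** [rej k] is the event that the [k]-th hypothesis is rejected. *)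
Definition FWER (d : measure_display) (T : measurableType d) (R : realType)
    (K : nat) (H : 'I_K -> set (probability T R)) (rej : 'I_K -> set T)
    (P : probability T R) : \bar R :=
  P [set w | exists2 k, H k P & rej k w].

(* Main.v *)
Require Import Defs.
From HB Require Import structures.
From mathcomp Require Import all_boot all_order all_algebra.
From mathcomp Require Import all_classical all_reals all_analysis.
From mathcomp Require Import measurable_realfun ring lra.

Set Implicit Arguments.
Unset Strict Implicit.
Unset Printing Implicit Defensive.

Import Order.TTheory GRing.Theory Num.Theory.
Import numFieldNormedType.Exports.

Local Open Scope classical_set_scope.
Local Open Scope ring_scope.

(** Write c = r / (r + 1), read as 1 for r = -oo; since r < -1, c >= 1. There
    are two parts.

    Closed testing: if I is the nonempty set of true hypotheses, a procedure
    that rejects some k in I must in particular have found the combined p-value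
    of I itself to be at most eps. Hence it suffices to show that the combined
    p-value of n arbitrarily dependent p-values is at most eps with probability
    at most eps ([merged_pvalue_valid]). The minimum of the adjusted p-values
    over I is at most eps on exactly the same event ([rejectsE]), so both
    conclusions are the same bound ([closed_testing]).

    Validity of the combination: put delta = eps / (n c). For finite r, raising
    to the negative power r turns the rejection event into
    sum_i (q_i / delta)^r >= 1, and this is unchanged if each summand is capped
    at 1, because one summand of size 1 is already enough; for r = -oo the
    capped summands become the indicators of q_i <= delta
    ([merged_le_capped_sum]). By Markov's inequality and linearity of the
    expectation, which ignores the dependence, the event has probability at most
    n times the largest expectation of a capped summand. That expectation is at
    most c delta = eps / n ([expectation_capped_power]): the capped power of a
    p-value exceeds u < 1 only if the p-value is at most delta u^(1/r), which has
    probability at most delta u^(1/r), and the integral of u^(1/r) over [0, 1]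
    is c. The last integral converges because r < -1, and this is where the
    constant c comes from. *)

(** * Negative powers *)

Lemma ler_powR_neg (R : realType) (s x y : R) : s < 0 -> 0 < x -> 0 < y ->
  (x `^ s <= y `^ s) = (y <= x).
Proof.
move=> s0 x0 y0; rewrite /powR !gt_eqF// ler_expR ler_nM2l//.
by rewrite ler_ln ?posrE.
Qed.

Lemma ler_powR_inv (R : realType) (s x y : R) : s < 0 -> 0 < x -> 0 < y ->
  (y <= x `^ s) = (x <= y `^ s^-1).
Proof.
move=> s0 x0 y0; rewrite -[RHS](@ler_powR_neg _ s)// ?powR_gt0//.
by rewrite -powRrM mulVf ?lt_eqF// powRr1// ltW.
Qed.

(** * Capped powers of p-values *)

Definition superuniform (R : realType) d (T : measurableType d)
    (P : probability T R) (X : {mfun T >-> R}) : Prop :=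
  forall eps : R, 0 < eps < 1 -> (P [set w | (X w <= eps)%R] <= eps%:E)%E.

(** For r = s%:E with s < 0 this is min(1, (x / delta)^s), and for r = -oo its
    pointwise limit, the indicator of x <= delta. Testing x <= delta first gives
    the value 1 at x = 0, where (x / delta) `^ s is 0 instead of +oo. *)
Definition capped_power (R : realType) (r : \bar R) (delta x : R) : R :=
  if x <= delta then 1 else if r is s%:E then (x / delta) `^ s else 0.

Lemma measurable_capped_power (R : realType) (r : \bar R) (delta : R) :
  measurable_fun [set: R] (capped_power r delta).
Proof.
apply: measurable_fun_ifT => //.
  exact: measurable_fun_ler.
case: r => [s| |] //.
apply: (measurableT_comp (measurable_powR s)).
exact: measurable_funM.
Qed.

HB.instance Definition _ (R : realType) (r : \bar R) (delta : R) :=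
  isMeasurableFun.Build _ _ _ _ (capped_power r delta)
    (measurable_capped_power r delta).

(** The integral of u `^ r^-1 over [0, 1], including the limit for r = -oo. *)
Definition tail_factor (R : realType) (r : \bar R) : R :=
  if r is s%:E then s / (s + 1) else 1.

Lemma capped_power_ge0 (R : realType) (r : \bar R) (delta x : R) :
  0 <= capped_power r delta x.
Proof.
rewrite /capped_power; case: ifP => // _.
by case: r => // s; exact: powR_ge0.
Qed.

Lemma ge1_tail_factor (R : realType) (r : \bar R) :
  (r < (-1)%:E)%E -> 1 <= tail_factor r.
Proof.
case: r => [s| |] //=; rewrite lte_fin => s1.
by rewrite ler_ndivlMr ?mul1r; lra.
Qed.

Lemma measurable_mfun_le (R : realType) d (T : measurableType d)
    (X : {mfun T >-> R}) (e : R) : measurable [set w | X w <= e].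
Proof.
rewrite (_ : [set _ | _] = X @^-1` `]-oo, e]).
  by rewrite -[X in measurable X]setTI; exact: measurable_funP.
by apply/seteqP; split=> w /=; rewrite in_itv.
Qed.

(** For u < 1, the capped power exceeds u only if X <= delta * u `^ s^-1. *)
Lemma ccdf_capped_power (R : realType) d (T : measurableType d)
    (P : probability T R) (X : {mfun T >-> R}) (s delta u : R) :
  s < -1 -> 0 < delta ->
  superuniform P X ->
  0 < u ->
  (ccdf (P := P) (capped_power s%:E delta \o X : {mfun T >-> R}) u <=
     (if u < 1 then delta * u `^ s^-1 else 0)%:E)%E.
Proof.
move=> s1 d0 PX u0; rewrite /ccdf /distribution /pushforward/=.
set E := (X in P X).
have mE : measurable E by rewrite -[E]setTI; exact: measurable_funP.
have [u1|u1] := ltP u 1; last first.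
  rewrite (_ : E = set0) ?measure0//.
  apply/seteqP; split=> w //; rewrite /E /= in_itv /= andbT /capped_power.
  case: ifPn => [_|]; first by rewrite ltNge u1.
  rewrite -ltNge => dX; rewrite ltNge => /negP; apply; apply: le_trans u1.
  rewrite -(powRr0 (X w / delta)); apply: ler_powR; last lra.
  by rewrite ler_pdivlMr// mul1r ltW.
set v := delta * _.
have v0 : 0 < v by rewrite mulr_gt0// powR_gt0.
have [v1|v1] := ltP v 1; last first.
  by apply: le_trans (probability_le1 _ mE) _; rewrite lee_fin.
apply: le_trans (PX v _); last by rewrite v0.
apply: le_measure; rewrite ?inE//; first exact: measurable_mfun_le.
move=> w; rewrite /E /= in_itv /= andbT /capped_power.
case: ifPn => [Xd _|].
  apply: le_trans Xd _; rewrite ler_pMr//.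
  rewrite -(powRr0 u); apply: ger_powR; first by rewrite u0 ltW.
  by rewrite invr_le0; lra.
rewrite -ltNge => dX /ltW.
have X0 := lt_trans d0 dX.
rewrite ler_powR_inv ?divr_gt0//; last lra.
by rewrite ler_pdivrMr// mulrC.
Qed.

Lemma integral_powR_to1 (R : realType) (s a : R) : s < -1 -> 0 < a -> a < 1 ->
  (\int[lebesgue_measure]_(u in `[a, 1%R]) (u `^ s^-1)%:E =
    (s / (s + 1) * (1 - a `^ (1 + s^-1)))%:E)%E.
Proof.
move=> s1 a0 a1.
have s0 : s != 0 by rewrite lt_eqF//; lra.
have cE : s / (s + 1) * (1 + s^-1) = 1.
  by field; rewrite s0/= lt_eqF//; lra.
pose F : R -> R := (s / (s + 1)) \*: (@powR R ^~ (1 + s^-1)).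
have dF (x : R) : 0 < x -> is_derive x (1:R) F (x `^ s^-1).
  move=> x0.
  apply: (@is_derive_eq _ _ _ _ _ _ _ _ (is_deriveZ _ (is_derive1_powR _ x0))).
  by rewrite addrAC subrr add0r /GRing.scale/= mulrA cE mul1r.
have df (x : R) : 0 < x ->
    is_derive x (1:R) (@powR R ^~ s^-1) (s^-1 * x `^ (s^-1 - 1)).
  by move=> x0; exact: is_derive1_powR.
have cF (x : R) : 0 < x -> {for x, continuous F}.
  move=> x0; apply: differentiable_continuous; apply/derivable1_diffP.
  by have := dF x x0; case.
rewrite (@continuous_FTC2 _ _ F)//.
- by rewrite /F /= powR1 /GRing.scale /= mulr1 -EFinB; congr EFin; ring.
- apply: derivable_within_continuous => x; rewrite in_itv/= => /andP[ax _].
  by have := df x (lt_le_trans a0 ax); case.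
- split.
  + move=> x; rewrite in_itv/= => /andP[ax _].
    by have := dF x (lt_trans a0 ax); case.
  + by apply: cvg_at_right_filter; exact: cF.
  + by apply: cvg_at_left_filter; exact: cF.
- move=> x; rewrite in_itv/= => /andP[ax _]; rewrite derive1E.
  by have := dF x (lt_trans a0 ax); case.
Qed.

(** The expectation is the integral of the tail probability over u >= 0. That
    probability is bounded by 1 and by delta * u `^ s^-1; the two bounds cross at
    u = delta `^ (- s), and using the first one below the crossing point avoids
    the singularity of the second one at 0. *)
Lemma expectation_capped_power_fin (R : realType) d (T : measurableType d)
    (P : probability T R) (X : {mfun T >-> R}) (s delta : R) :
  s < -1 -> 0 < delta < 1 ->
  superuniform P X ->
  (\int[P]_w (capped_power s%:E delta (X w))%:E <=
    (tail_factor s%:E * delta)%:E)%E.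
Proof.
move=> s1 /andP[d0 d1] PX.
pose Y : {mfun T >-> R} := capped_power s%:E delta \o X.
have Y0 w : 0 <= Y w by exact: capped_power_ge0.
have := ge0_expectation_ccdf (P := P) Y0; rewrite unlock => ->.
(* a solves delta * a `^ s^-1 = 1 *)
pose a := delta `^ (- s).
have a0 : 0 < a by exact: powR_gt0.
have a1 : a < 1.
  rewrite /a -(powRr0 delta) /powR gt_eqF// ltr_expR.
  by rewrite mul0r pmulr_rlt0; [apply: ln_lt0; rewrite d0|lra].
have mG : measurable_fun [set: R] (ccdf (P := P) Y) by exact: ccdf_measurable.
have G0 u : (0 <= ccdf (P := P) Y u)%E by exact: measure_ge0.
have mG' (A : set R) : measurable_fun A (ccdf (P := P) Y).
  exact: measurable_funS mG.
have -> : `[0, +oo[%classic = `[0, a[ `|` (`[a, 1] `|` `]1, +oo[) :> set R.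
  rewrite -(@itv_bndbnd_setU _ _ _ (BRight 1)) ?bnd_simp//; last exact: ltW.
  by rewrite -(@itv_bndbnd_setU _ _ _ (BLeft a)) ?bnd_simp//; exact: ltW.
rewrite ge0_integral_setU//=; last 3 first.
- exact: measurableU.
- exact: mG'.
- apply/disj_setPS => u /=.
  rewrite !in_itv/= andbT => -[/andP[_ ua] [/andP[au _]|u1]].
    by rewrite leNgt ua in au.
  by have := lt_trans (lt_trans u1 ua) a1; rewrite ltxx.
rewrite ge0_integral_setU//=; last 2 first.
- exact: mG'.
- apply/disj_setPS => u /=; rewrite !in_itv/= andbT => -[/andP[_ u1]].
  by rewrite ltNge u1.
have tail := ccdf_capped_power s1 d0 PX.
have pa : a `^ s^-1 = delta^-1.
  rewrite -powRrM mulNr mulfV ?lt_eqF//; last lra.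
  by rewrite powR_inv1// ltW.
have c1 : 1 <= s / (s + 1).
  exact: (@ge1_tail_factor _ s%:E).
have low :
    (\int[lebesgue_measure]_(u in `[0%R, a[) ccdf (P := P) Y u <= a%:E)%E.
  apply: (@le_trans _ _ (\int[lebesgue_measure]_(u in `[0%R, a[) cst 1 u)%E).
    apply: ge0_le_integral => //= [|u _]; first exact: mG'.
    by apply: probability_le1; exact: measurable_itv.
  by rewrite integral_cst// mul1e /= lebesgue_measure_itv/= lte_fin a0 sube0.
have mid : (\int[lebesgue_measure]_(u in `[a, 1%R]) ccdf (P := P) Y u <=
    (delta * (s / (s + 1) * (1 - a `^ (1 + s^-1))))%:E)%E.
  rewrite EFinM -integral_powR_to1// -ge0_integralZl_EFin//; last 3 first.
  - by move=> u _; rewrite lee_fin powR_ge0.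
  - apply/measurable_EFinP; apply: measurable_funTS.
    exact: measurable_powR.
  - exact: ltW.
  apply: ge0_le_integral => //=; first exact: mG'.
    apply/measurable_EFinP; apply: measurable_funM => //.
    apply: measurable_funTS.
    exact: measurable_powR.
  move=> u; rewrite in_itv/= => /andP[au _].
  have u0 := lt_le_trans a0 au.
  apply: (le_trans (tail _ u0)); rewrite -EFinM lee_fin; case: ifP => // _.
  by rewrite mulr_ge0 ?powR_ge0 ?ltW.
have high :
    (\int[lebesgue_measure]_(u in `]1%R, +oo[) ccdf (P := P) Y u <= 0)%E.
  apply: (@le_trans _ _ (\int[lebesgue_measure]_(u in `]1%R, +oo[) cst 0 u)%E).
    apply: ge0_le_integral => //= [|u]; first exact: mG'.
    rewrite in_itv/= andbT => u1.
    apply: (le_trans (tail _ (lt_trans ltr01 u1))).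
    by rewrite ltNge (ltW u1) lexx.
  by rewrite integral_cst// mul0e.
apply: le_trans (leeD low (leeD mid high)) _.
rewrite adde0 -EFinD lee_fin powRD; last by rewrite (gt_eqF a0) implybT.
rewrite pa powRr1 ?(ltW a0)//=.
(* the pieces add up to a + c * delta - c * a with c >= 1 *)
rewrite (_ : _ + _ = s / (s + 1) * delta - (s / (s + 1) - 1) * a); last first.
  by field; rewrite (gt_eqF d0)/= lt_eqF//; lra.
by rewrite gerBl; apply: mulr_ge0; [rewrite subr_ge0|exact: ltW].
Qed.

Lemma expectation_capped_power (R : realType) d (T : measurableType d)
    (P : probability T R) (X : {mfun T >-> R}) (r : \bar R) (delta : R) :
  (r < (-1)%:E)%E -> 0 < delta < 1 ->
  superuniform P X ->
  (\int[P]_w (capped_power r delta (X w))%:E <= (tail_factor r * delta)%:E)%E.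
Proof.
case: r => [s| |] //=; first exact: expectation_capped_power_fin.
move=> _ d01 PX; rewrite mul1r.
have mE : measurable [set w | X w <= delta] by exact: measurable_mfun_le.
apply: le_trans (PX _ d01).
rewrite (eq_integral (fun w => (\1_[set w | X w <= delta] w)%:E)); last first.
  by move=> w _; rewrite indicE /capped_power; congr EFin; case: ifPn => h;
     [rewrite mem_set|rewrite memNset//; exact/negP].
by rewrite integral_indic// setIT.
Qed.

(** * The combined p-value *)

Lemma ge1_sum_capped_power (R : realType) (r : \bar R) (n : nat) (delta : R)
    (q : 'I_n -> R) (i : 'I_n) :
  q i <= delta -> 1 <= \sum_i capped_power r delta (q i).
Proof.
move=> qd; rewrite (bigD1 i)//= {1}/capped_power qd lerDl sumr_ge0// => j _.
exact: capped_power_ge0.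
Qed.

(** If a term is capped, both sides hold on account of that term alone;
    otherwise the sums coincide. *)
Lemma ge1_sum_capped_powerE (R : realType) (s : R) (n : nat) (delta : R)
    (q : 'I_n -> R) : s <= 0 -> 0 < delta -> (forall i, 0 < q i) ->
  (1 <= \sum_i capped_power s%:E delta (q i)) =
  (1 <= \sum_i (q i / delta) `^ s).
Proof.
move=> s0 d0 q0; have [[i qd]|nqd] := pselect (exists i, q i <= delta).
  rewrite (ge1_sum_capped_power _ qd); apply/esym.
  apply: (@le_trans _ _ ((q i / delta) `^ s)).
    rewrite -[leLHS](powRr0 (q i / delta)); apply: ger_powR => //.
    by rewrite divr_gt0//= ler_pdivrMr// mul1r.
  by rewrite (bigD1 i)//= lerDl sumr_ge0// => j _; exact: powR_ge0.
congr (_ <= _); apply: eq_bigr => i _; rewrite /capped_power ifN//.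
by apply/negP => qd; apply: nqd; exists i.
Qed.

(** The coefficient n ^ (1 + 1 / s) absorbs the division by n in the mean, so
    that merging amounts to comparing n * c * S `^ s^-1 with eps, where S is the
    sum of the q i `^ s. *)
Lemma merge_le_powerE (R : realType) (s : R) (n : nat) (eps : R)
    (q : 'I_n -> R) :
  s < -1 -> (0 < n)%N -> 0 < eps -> (forall i, 0 < q i) ->
  (merge_coef s%:E n * genmean s%:E q <= eps) =
  (1 <= \sum_i (q i / (eps / (n%:R * tail_factor s%:E))) `^ s).
Proof.
move=> s1 n0 e0 q0.
have c1 : 1 <= tail_factor s%:E := @ge1_tail_factor _ s%:E s1.
have c0 : 0 < tail_factor s%:E by lra.
have nR0 : 0 < n%:R :> R by rewrite ltr0n.
set delta := eps / _.
have d0 : 0 < delta by rewrite divr_gt0// mulr_gt0.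
have s0 : s < 0 by lra.
have S0 : 0 < \sum_i q i `^ s.
  rewrite (bigD1 (Ordinal n0))//= ltr_pwDl ?powR_gt0// sumr_ge0// => j _.
  exact: powR_ge0.
have -> : genmean s%:E q = ((\sum_i q i `^ s) / n%:R) `^ s^-1.
  rewrite /genmean ifN//; apply/negP => /existsP[i].
  by rewrite gt_eqF.
have -> : \sum_i (q i / delta) `^ s = (\sum_i q i `^ s) / delta `^ s.
  rewrite mulr_suml; apply: eq_bigr => i _.
  by rewrite powRM ?invr_ge0 ?ltW// -powR_inv1 ?ltW// powRAC powR_inv1 ?powR_ge0.
rewrite ler_pdivlMr ?powR_gt0// mul1r.
have -> : (delta `^ s <= \sum_i q i `^ s) =
    ((\sum_i q i `^ s) `^ s^-1 <= delta).
  rewrite -[RHS](@ler_powR_neg _ s) ?powR_gt0//.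
  by rewrite -powRrM mulVf ?lt_eqF// powRr1// ltW.
have -> : merge_coef s%:E n * ((\sum_i q i `^ s) / n%:R) `^ s^-1 =
    (\sum_i q i `^ s) `^ s^-1 * (n%:R * tail_factor s%:E).
  rewrite /= powRD; last by rewrite (gt_eqF nR0) implybT.
  rewrite powRr1 ?ltW// powRM ?invr_ge0 ?ltW//.
  have -> : n%:R^-1 `^ s^-1 = (n%:R `^ s^-1)^-1 :> R.
    by rewrite -powR_inv1 ?ltW// powRAC powR_inv1 ?powR_ge0.
  have : n%:R `^ s^-1 != 0 :> R by rewrite gt_eqF ?powR_gt0.
  by move=> h; field; rewrite h lt_eqF//; lra.
by rewrite -ler_pdivlMr// mulr_gt0.
Qed.

(** The rejection event as a threshold on a sum of functions of the single
    p-values: additivity makes the joint distribution irrelevant for its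
    expectation, and measurability follows from that of [capped_power]. *)
Lemma merged_le_capped_sum (R : realType) (r : \bar R) (n : nat) (eps : R)
    (q : 'I_n -> R) :
  (r < (-1)%:E)%E -> (0 < n)%N -> 0 < eps < 1 -> (forall i, 0 <= q i) ->
  (merge_coef r n * genmean r q <= eps) =
  (1 <= \sum_i capped_power r (eps / (n%:R * tail_factor r)) (q i)).
Proof.
move=> r1 n0 /andP[e0 e1] q0.
have c1 := ge1_tail_factor r1.
have n1 : 1 <= n%:R :> R by rewrite ler1n.
have d0 : 0 < eps / (n%:R * tail_factor r) by rewrite divr_gt0// mulr_gt0//; lra.
case: r r1 c1 d0 => [s| |] //.
  rewrite lte_fin => r1 _ d0.
  have [[i qi0]|q_neq0] := pselect (exists i, q i = 0).
    rewrite (@ge1_sum_capped_power _ _ _ _ _ i) ?qi0 ?ltW//.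
    by rewrite /genmean ifT ?mulr0 ?ltW//; apply/existsP; exists i; apply/eqP.
  have {}q0 i : 0 < q i.
    by rewrite lt0r q0 andbT; apply/eqP => qi0; apply: q_neq0; exists i.
  have s0 : s <= 0 by lra.
  by rewrite (ge1_sum_capped_powerE s0 d0 q0) merge_le_powerE.
move=> _ _; rewrite /tail_factor mulr1 /= => d0.
rewrite mulrC -ler_pdivlMr ?(lt_le_trans _ n1)//.
apply/idP/idP => [/bigmin_leP[|[i _ qi]]|].
- by rewrite ler_pdivlMr ?mul1r ?(lt_le_trans _ n1)//; lra.
- exact: ge1_sum_capped_power qi.
apply: contraTT => /bigmin_leP nqd; rewrite -ltNge big1// => i _.
by rewrite /capped_power ifN//; apply/negP => qd; apply: nqd; right; exists i.
Qed.

Lemma measurable_merged_event (R : realType) d (T : measurableType d)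
    (r : \bar R) (n : nat) (eps : R) (q : 'I_n -> {mfun T >-> R}) :
  (r < (-1)%:E)%E -> (0 < n)%N -> 0 < eps < 1 -> (forall i w, 0 <= q i w) ->
  measurable [set w | merge_coef r n * genmean r (q ^~ w) <= eps].
Proof.
move=> r1 n0 e01 q0.
set delta := eps / (n%:R * tail_factor r).
rewrite (_ : [set _ | _] =
    (fun w => \sum_i capped_power r delta (q i w)) @^-1` `[1, +oo[).
  rewrite -[X in measurable X]setTI.
  apply: measurable_sum => // i.
  exact: (measurable_funPT (capped_power r delta \o q i)).
by apply/seteqP; split => w /=; rewrite in_itv/= andbT merged_le_capped_sum.
Qed.

(** Markov's inequality for the sum of the capped powers, whose expectation is
    additive under any dependence between the q i. *)
Lemma merged_pvalue_valid (R : realType) d (T : measurableType d)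
    (P : probability T R) (r : \bar R) (n : nat) (eps : R)
    (q : 'I_n -> {mfun T >-> R}) :
  (r < (-1)%:E)%E -> (0 < n)%N -> 0 < eps < 1 -> (forall i w, 0 <= q i w) ->
  (forall i, superuniform P (q i)) ->
  (P [set w | (merge_coef r n * genmean r (q ^~ w) <= eps)%R] <= eps%:E)%E.
Proof.
move=> r1 n0 e01 q0 Pq.
have mE := measurable_merged_event r1 n0 e01 q0.
set E := [set w | _] in mE *.
have c1 := ge1_tail_factor r1.
have n1 : 1 <= n%:R :> R by rewrite ler1n.
have nc1 : 1 <= n%:R * tail_factor r by rewrite -[leLHS]mulr1 ler_pM.
set delta := eps / (n%:R * tail_factor r).
have d01 : 0 < delta < 1.
  case/andP: e01 => e0 e1; rewrite divr_gt0/= ?ltr_pdivrMr ?mul1r; lra.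
pose f i w := (capped_power r delta (q i w))%:E.
have mf i : measurable_fun [set: T] (f i).
  apply/measurable_EFinP.
  exact: (measurable_funPT (capped_power r delta \o q i)).
have f0 i w : [set: T] w -> (0 <= f i w)%E.
  by move=> _; rewrite lee_fin capped_power_ge0.
rewrite -[E]setIT -integral_indic//.
apply: (@le_trans _ _ (\int[P]_w (\sum_i f i w))%E).
  apply: ge0_le_integral => //.
  - exact/measurable_EFinP.
  - exact: emeasurable_sum.
  - move=> w _; rewrite indicE sumEFin lee_fin.
    have [wE|_] := boolP (w \in E); last first.
      by rewrite sumr_ge0// => i _; exact: capped_power_ge0.
    by move: wE; rewrite inE /E/= merged_le_capped_sum.
rewrite ge0_integral_sum//.
apply: (@le_trans _ _ (\sum_(i < n) (tail_factor r * delta)%:E)%E).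
  by apply: lee_sum => i _; exact: expectation_capped_power (Pq i).
rewrite sumEFin lee_fin sumr_const card_ord -mulr_natl mulrA.
by rewrite /delta mulrC divfK// gt_eqF//; lra.
Qed.

(** * Closed testing *)

Lemma rejectsE (R : realType) (T : Type) (K : nat) (r : \bar R)
    (p : 'I_K -> T -> R) (eps : R) (k : 'I_K) (w : T) : 0 <= eps ->
  (adjusted_pvalue r p k w <= eps) <-> rejects r p eps k w.
Proof.
move=> e0; split=> [/bigmax_leP[_ h] I kI|h]; first exact: h.
by apply/bigmax_leP; split=> // I kI; exact: h.
Qed.

(** Rejecting some true hypothesis requires the combined p-value of the set of
    all true hypotheses to be at most eps. *)
Lemma closed_testing (R : realType) (d : measure_display)
    (T : measurableType d) (K : nat) (r : \bar R)
    (H : 'I_K -> set (probability T R)) (p : 'I_K -> {mfun T >-> R})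
    (eps : R) (P : probability T R) :
  (r < (-1)%:E)%E -> (forall k w, 0 <= p k w <= 1) ->
  (forall k, is_pvalue (H k) (p k)) -> 0 < eps < 1 ->
  (FWER H (rejects r p eps) P <= eps%:E)%E.
Proof.
move=> r1 p01 pP e01.
pose I := [set k : 'I_K | `[< H k P >]]%SET.
pose merged_ev (J : {set 'I_K}) := [set w | merged_pvalue r p J w <= eps].
have I_gt0 (J : {set 'I_K}) k : k \in J -> (0 < #|J|)%N.
  by move=> kJ; apply/card_gt0P; exists k.
have m_ev (J : {set 'I_K}) : (0 < #|J|)%N -> measurable (merged_ev J).
  move=> J0.
  apply: (measurable_merged_event (q := fun j => p (enum_val j))) => //.
  by move=> j w; have /andP[] := p01 (enum_val j) w.
rewrite /FWER.
have m_rej : measurable [set w | exists2 k, H k P & rejects r p eps k w].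
  rewrite (_ : [set _ | _] = \bigcup_(k in [set k | H k P])
      \bigcap_(J in [set J : {set 'I_K} | k \in J]) merged_ev J)//.
  apply: fin_bigcup_measurable => [|k _]; first exact: finite_finset.
  apply: fin_bigcap_measurable => [|J kJ]; first exact: finite_finset.
  exact/m_ev/(I_gt0 _ k).
have [I0|/set0Pn[k kI]] := eqVneq I finset.set0.
  rewrite (_ : [set _ | _] = set0) ?measure0 ?lee_fin.
    by case/andP: e01 => /ltW.
  apply/seteqP; split=> w // -[k Hk _].
  suff : k \in I by rewrite I0 inE.
  by rewrite inE; apply/asboolP.
have card_I := I_gt0 _ _ kI.
apply: (@le_trans _ _ (P (merged_ev I))).
  apply: le_measure; rewrite ?inE//; first exact: m_ev.
  move=> w [j Hj]; apply; rewrite inE; exact/asboolP.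
apply: (merged_pvalue_valid (q := fun j => p (enum_val j))) => //.
  by move=> j w; have /andP[] := p01 (enum_val j) w.
move=> j e e_01; apply: pP => //.
by have := enum_valP j; rewrite inE => /asboolP.
Qed.

(* The iterated minimum is taken in the extended reals with unit +oo: the
   adjusted p-values may exceed 1, and the index set is nonempty. *)
Theorem mainTheorem12 (R : realType) (d : measure_display)
    (T : measurableType d) (K : nat) (hK : (2 <= K)%N)
    (r : \bar R) (hr : (r < (-1)%:E)%E)
    (H : 'I_K -> set (probability T R))
    (p : 'I_K -> {mfun T >-> R})
    (p01 : forall k w, 0 <= p k w <= 1)
    (pP : forall k, is_pvalue (H k) (p k)) :
  (forall P : probability T R, (exists k, H k P) ->
   forall eps : R, 0 < eps < 1 ->
   (P [set w | \big[mine/+oo]_(k < K | P \in H k)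
                 (adjusted_pvalue r p k w)%:E <= eps%:E] <= eps%:E)%E) /\
  (forall eps : R, 0 < eps < 1 -> forall P : probability T R,
   (FWER H (rejects r p eps) P <= eps%:E)%E).
Proof.
have e_FWER eps P : 0 < eps < 1 -> (FWER H (rejects r p eps) P <= eps%:E)%E.
  exact: closed_testing.
split=> [P _ eps e01|eps e01 P]; last exact: e_FWER.
rewrite (_ : [set w | _] = [set w | exists2 k, H k P & rejects r p eps k w]).
  exact: e_FWER.
have e0 : 0 <= eps by case/andP: e01 => /ltW.
apply/seteqP; split=> w /=.
  move=> /bigmin_leP[|[k]]; first by rewrite leye_eq.
  by rewrite inE lee_fin => Hk /(rejectsE _ _ _ _ e0); exists k.
case=> k Hk /(rejectsE _ _ _ _ e0) le_eps.
by apply/bigmin_leP; right; exists k; rewrite ?inE.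
Qed.
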